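(* Let $u$ range over smooth axisymmetric Navier–Stokes solutions with viscosity $\nu>0$, with $\Gamma=ru^\theta$, $b=(u^r,u^z)$. For $p>0$ and $k\in\mathbb R$, on regions where $\Gamma$ is nonvanishing, put $\rho_{p,k}=|\Gamma|^pr^{-k}$ and $c_p=b-p\nu\nabla\log|\Gamma|$. No choice of circulation power $|\Gamma|^p$ and radial power $r^{-k}$ simultaneously produces both (a) a compression-free continuity law, i.e. vanishing of the coefficient of the compression $q=-u^r/r$ in the expression for $\partial_t\rho_{p,k}+\nabla\cdot(\rho_{p,k}c_p)$, and (b) a scale-zero current action $\iint\rho_{p,k}|c_p|^2\,dr\,dz\,dt$.
   Context: $\nabla=(\partial_r,\partial_z)$ and $\nabla\cdot$ is the flat divergence in $(r,z)$. With $\phi=\log|\Gamma|$, the continuity law for $\rho_{p,k}$ is $$\partial_t\rho_{p,k}+\nabla\cdot(\rho_{p,k}c_p)=\rho_{p,k}\left[(k+1)q+p\nu\left((k-1)\frac{\phi_r}{r}-(p-1)|\nabla\phi|^2\right)\right].$$ The action is scale-zero if it is invariant under Navier–Stokes scaling, i.e. if, for $u(x,t)=R^{-1}\hat u(x/R,t/R^2)$ with any $R>0$, the action of $u$ on a space-time region equals the action of $\hat u$ on the correspondingly rescaled region. *)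

(* Defs.v *)
From HB Require Import structures.
From mathcomp Require Import all_boot all_order all_algebra.
From mathcomp Require Import all_classical all_reals all_analysis.

Set Implicit Arguments.
Unset Strict Implicit.
Unset Printing Implicit Defensive.

Import Order.TTheory GRing.Theory Num.Theory.
Import numFieldNormedType.Exports.

Local Open Scope classical_set_scope.
Local Open Scope ring_scope.

(* Space-time R^3 x R: Cartesian position and time. *)
Notation spacetime R := ('rV[R]_3 * R)%type.

Section cartesian.
Variable R : realType.
Implicit Types (D : set (spacetime R)) (nu : R).

Definition vec3 (a b c : R) : 'rV[R]_3 := \row_(i < 3) [:: a; b; c]`_i.

Definition dir_x (i : 'I_3) : spacetime R := (delta_mx 0 i, 0).
Definition dir_t : spacetime R := (0, 1).

Definition iter_derive (vs : seq (spacetime R)) (f : spacetime R -> R) :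
    spacetime R -> R :=
  foldr (fun v g => fun y => 'D_v g y) f vs.

(* C^oo on the open set D: directional derivatives of all orders exist and are
   continuous. *)
Definition smooth_on D (f : spacetime R -> R) : Prop :=
  forall vs : seq (spacetime R), forall y, D y ->
    {for y, continuous (iter_derive vs f)} /\
    (forall v, derivable (iter_derive vs f) y v).

Definition rotz (th : R) (x : 'rV[R]_3) : 'rV[R]_3 :=
  vec3 (cos th * x 0 0 - sin th * x 0 1)
       (sin th * x 0 0 + cos th * x 0 1)
       (x 0 2%:R).

Definition rotation_invariant D : Prop :=
  forall (th : R) x t, D (x, t) -> D (rotz th x, t).

Definition axisymmetric_on D (u : spacetime R -> 'rV[R]_3) : Prop :=
  forall (th : R) x t, D (x, t) -> u (rotz th x, t) = rotz th (u (x, t)).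

(* Incompressible, unforced, unit density; pr is the pressure. *)
Definition navier_stokes_on D nu (u : spacetime R -> 'rV[R]_3)
    (pr : spacetime R -> R) : Prop :=
  forall y, D y ->
    (forall i : 'I_3,
      'D_dir_t (fun w => u w 0 i) y
        + \sum_(j < 3) u y 0 j * 'D_(dir_x j) (fun w => u w 0 i) y
      = - 'D_(dir_x i) pr y
        + nu * \sum_(j < 3)
                 'D_(dir_x j) ('D_(dir_x j) (fun w => u w 0 i)) y) /\
    \sum_(i < 3) 'D_(dir_x i) (fun w => u w 0 i) y = 0.

Definition smooth_axisymmetric_NS D nu (u : spacetime R -> 'rV[R]_3) : Prop :=
  [/\ forall i : 'I_3, smooth_on D (fun w => u w 0 i),
      axisymmetric_on D u &
      exists2 pr, smooth_on D pr & navier_stokes_on D nu u pr].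

Definition rescale (l : R) (u : spacetime R -> 'rV[R]_3) :
    spacetime R -> 'rV[R]_3 :=
  fun w => l^-1 *: u (l^-1 *: w.1, w.2 / l ^+ 2).

End cartesian.

Section meridional.
Variable R : realType.
Implicit Types (u : spacetime R -> 'rV[R]_3) (f : R -> R -> R -> R).

(* Functions of (r, z, t) are read off on the half-plane {y = 0, r = x > 0}.
   There the cylindrical frame (e_r, e_theta, e_z) is the Cartesian one, and
   axisymmetry makes the components independent of the angle. *)
Definition meridian (r z t : R) : spacetime R := (vec3 r 0 z, t).

Definition ur u r z t : R := u (meridian r z t) 0 0.
Definition utheta u r z t : R := u (meridian r z t) 0 1.
Definition uz u r z t : R := u (meridian r z t) 0 2%:R.

Definition dr f r z t : R := derive1 (fun s => f s z t) r.
Definition dz f r z t : R := derive1 (fun s => f r s t) z.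
Definition dt f r z t : R := derive1 (fun s => f r z s) t.

Definition Gam u r z t : R := r * utheta u r z t.
Definition phi u r z t : R := ln `|Gam u r z t|.
Definition compression u r z t : R := - (ur u r z t / r).

Definition rho (p k : R) u r z t : R := `|Gam u r z t| `^ p * r `^ (- k).
Definition cr (nu p : R) u r z t : R := ur u r z t - p * nu * dr (phi u) r z t.
Definition cz (nu p : R) u r z t : R := uz u r z t - p * nu * dz (phi u) r z t.

Definition circulating (D : set (spacetime R)) u : set (R * R * R) :=
  [set s | [/\ 0 < s.1.1, D (meridian s.1.1 s.1.2 s.2) &
               Gam u s.1.1 s.1.2 s.2 != 0]].

(* kappa is the coefficient of the compression in the continuity law of
   rho p k, valid for all solutions; the other terms of the right-hand side do
   not involve the compression. *)
Definition compression_coefficient (D : set (spacetime R)) (nu p k kappa : R) :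
    Prop :=
  forall u, smooth_axisymmetric_NS D nu u ->
  forall r z t, circulating D u (r, z, t) ->
    dt (rho p k u) r z t
      + (dr (fun r z t => rho p k u r z t * cr nu p u r z t) r z t
         + dz (fun r z t => rho p k u r z t * cz nu p u r z t) r z t)
    = rho p k u r z t *
      (kappa * compression u r z t
       + p * nu * ((k - 1) * (dr (phi u) r z t / r)
                   - (p - 1) * (dr (phi u) r z t ^+ 2
                                + dz (phi u) r z t ^+ 2))).

Definition compression_free (D : set (spacetime R)) (nu p k : R) : Prop :=
  compression_coefficient D nu p k 0.

Definition action (nu p k : R) u (A : set (R * R * R)) : \bar R :=
  (\int[(@lebesgue_measure R \x @lebesgue_measure R)
         \x @lebesgue_measure R]_(s in A)
    (rho p k u s.1.1 s.1.2 s.2 *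
     (cr nu p u s.1.1 s.1.2 s.2 ^+ 2 + cz nu p u s.1.1 s.1.2 s.2 ^+ 2))%:E)%E.

(* Image of A under (r, z, t) |-> (r / l, z / l, t / l^2), for l > 0. *)
Definition rescale_region (l : R) (A : set (R * R * R)) : set (R * R * R) :=
  [set s | A (l * s.1.1, l * s.1.2, l ^+ 2 * s.2)].

Definition scale_zero (D : set (spacetime R)) (nu p k : R) : Prop :=
  forall uh, smooth_axisymmetric_NS D nu uh ->
  forall (l : R) (A : set (R * R * R)), 0 < l -> measurable A ->
    rescale_region l A `<=` circulating D uh ->
    action nu p k (rescale l uh) A = action nu p k uh (rescale_region l A).

End meridional.

(* Main.v *)
(* Both conditions are tested on the strained solid-body rotation
     u^r = - a r,  u^theta = e^(2at) r,  u^z = 2 a z,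
   an exact Navier-Stokes solution on all of space-time for every viscosity.
   For a = 1 the compression is 1 and |Gamma| = e^(2t) r^2, so both sides of the
   continuity law are explicit and force the coefficient to be k + 1; a
   compression-free law thus needs k = -1. For a = 0 the action density is
   proportional to r^(2p-k-2), and the action scales by l^(2-k), which for
   k = -1 is l^3. *)
Require Import Defs.
From HB Require Import structures.
From mathcomp Require Import all_boot all_order all_algebra.
From mathcomp Require Import all_classical all_reals all_analysis.
From mathcomp Require Import measurable_realfun ring lra.
Import Order.TTheory GRing.Theory Num.Theory.
Import numFieldNormedType.Exports.
Local Open Scope classical_set_scope.
Local Open Scope ring_scope.

Set Implicit Arguments.
Unset Strict Implicit.
Unset Printing Implicit Defensive.

(** * Symbolic expressions and their exact derivatives *)

Section expressions.
Context {R : realType}.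

(* A syntax closed under directional derivatives: every expression is smooth,
   and the Navier-Stokes equations become polynomial identities. *)
Inductive expr : Type :=
| ECst of R
| ECoord of 'I_3
| ETime
| EAdd of expr & expr
| EMul of expr & expr
| EExp of expr.

Fixpoint eval (e : expr) (w : spacetime R) : R :=
  match e with
  | ECst a => a
  | ECoord i => w.1 0 i
  | ETime => w.2
  | EAdd e1 e2 => eval e1 w + eval e2 w
  | EMul e1 e2 => eval e1 w * eval e2 w
  | EExp e1 => expR (eval e1 w)
  end.

Fixpoint ederive (v : spacetime R) (e : expr) : expr :=
  match e with
  | ECst _ => ECst 0
  | ECoord i => ECst (v.1 0 i)
  | ETime => ECst v.2
  | EAdd e1 e2 => EAdd (ederive v e1) (ederive v e2)
  | EMul e1 e2 => EAdd (EMul e1 (ederive v e2)) (EMul e2 (ederive v e1))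
  | EExp e1 => EMul (EExp e1) (ederive v e1)
  end.

Lemma is_diff_eval (e : expr) (w : spacetime R) :
  is_diff w (eval e) (fun v => eval (ederive v e) w).
Proof.
elim: e => [a|i||e1 IH1 e2 IH2|e1 IH1 e2 IH2|e IH] /=.
- exact: is_diff_cst.
- pose f (w : spacetime R) : R := w.1 0 i.
  have lf : linear f by move=> a x y; rewrite /f /= !mxE.
  (* A coordinate is a continuous linear map, hence its own differential. *)
  pose fl : {linear spacetime R -> R} :=
    HB.pack f (GRing.isLinear.Build _ _ _ _ f lf).
  have cfl : continuous fl.
    move=> x; apply: (@continuous_comp _ _ _ fst (fun M : 'rV[R]_3 => M 0 i)).
      exact: cvg_fst.
    exact: coord_continuous.
  have dfl := linear_differentiable w cfl.
  by apply: DiffDef; [exact: dfl | exact: (diff_lin w cfl)].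
- pose f (w : spacetime R) : R := w.2.
  have lf : linear f by move=> a x y.
  pose fl : {linear spacetime R -> R} :=
    HB.pack f (GRing.isLinear.Build _ _ _ _ f lf).
  have cfl : continuous fl by move=> x; exact: cvg_snd.
  have dfl := linear_differentiable w cfl.
  by apply: DiffDef; [exact: dfl | exact: (diff_lin w cfl)].
- exact: is_diffD.
- exact: is_diffM.
- have dexp : is_diff (eval e w) expR (fun h : R => expR (eval e w) * h).
    have de : differentiable expR (eval e w).
      exact/derivable1_diffP/derivable_expR.
    apply: DiffDef => //; rewrite diff1E//; apply/funext => h /=.
    by rewrite derive1E derive_val /GRing.scale/= mulrC.
  exact: (is_diff_comp IH dexp).
Qed.

Lemma differentiable_eval (e : expr) (w : spacetime R) :
  differentiable (eval e) w.
Proof. by have [] := is_diff_eval e w. Qed.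

Lemma derive_eval (e : expr) (v w : spacetime R) :
  'D_v (eval e) w = eval (ederive v e) w.
Proof. by have [de dE] := is_diff_eval e w; rewrite deriveE// dE. Qed.

Lemma derive_evalE (e : expr) (v : spacetime R) :
  (fun w => 'D_v (eval e) w) = eval (ederive v e).
Proof. by apply/funext => w; rewrite derive_eval. Qed.

Lemma derive_eval2 (e : expr) (v v' w : spacetime R) :
  'D_v' ('D_v (eval e)) w = eval (ederive v' (ederive v e)) w.
Proof.
rewrite (_ : 'D_v (eval e) = eval (ederive v e)) ?derive_eval//.
exact: derive_evalE.
Qed.

Lemma smooth_on_eval (D : set (spacetime R)) (e : expr) : smooth_on D (eval e).
Proof.
move=> vs y _; suff [e' ->] : exists e', iter_derive vs (eval e) = eval e'.
  split; first exact/differentiable_continuous/differentiable_eval.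
  by move=> v; exact/diff_derivable/differentiable_eval.
elim: vs => [|v vs [e' /= ->]]; first by exists e.
by exists (ederive v e'); rewrite derive_evalE.
Qed.

End expressions.
Arguments expr : clear implicits.

(** A derivative depends only on the germ at [r], so closed forms containing [ln s], valid only for
    [s > 0], are enough. *)
Lemma dr_eq {R : realType} (f : R -> R -> R -> R) (g : R -> R) (r z t l : R) :
  0 < r -> (forall s, 0 < s -> f s z t = g s) -> is_derive r 1 g l ->
  dr f r z t = l.
Proof.
move=> r0 fg dg; rewrite /dr derive1E (near_eq_derive (g := g)).
  exact: derive_val.
by apply: filterS (lt_nbhsr r0) => s; exact: fg.
Qed.

Lemma is_derive_expR_comp {R : realType} (f : R -> R) (x df : R) :
  is_derive x 1 f df -> is_derive x 1 (fun s => expR (f s)) (expR (f x) * df).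
Proof. exact: (@is_derive1_comp _ expR f _ _ _ (is_derive_expR (f x))). Qed.

(** * The strained rotation and its current *)

Section strained_vortex.
Context {R : realType}.
Variables (a nu : R).

Definition spin : expr R := EExp (EMul (ECst (2 * a)) ETime).

Definition vortex_comp (i : 'I_3) : expr R :=
  nth (ECst 0)
    [:: EAdd (EMul (ECst (- a)) (ECoord 0))
          (EMul (ECst (- 1)) (EMul spin (ECoord 1)));
        EAdd (EMul spin (ECoord 0)) (EMul (ECst (- a)) (ECoord 1));
        EMul (ECst (2 * a)) (ECoord 2%:R)] i.

Definition vortex (w : spacetime R) : 'rV[R]_3 :=
  \row_i eval (vortex_comp i) w.

(** With spin rate s = e^(2at), the acceleration is (a^2 - s^2) times (x, y) horizontally and 4 a^2
    z vertically; this is minus the gradient of the present quadratic form. *)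
Definition vortex_pressure : expr R :=
  EAdd (EMul (EAdd (EMul (ECst 2^-1) (EMul spin spin)) (ECst (- (a ^+ 2 / 2))))
          (EAdd (EMul (ECoord 0) (ECoord 0)) (EMul (ECoord 1) (ECoord 1))))
       (EMul (ECst (- (2 * a ^+ 2))) (EMul (ECoord 2%:R) (ECoord 2%:R))).

Lemma vortex_compE (i : 'I_3) : (fun w => vortex w 0 i) = eval (vortex_comp i).
Proof. by apply/funext => w; rewrite mxE. Qed.

(** The velocity is linear in space, so the viscous term vanishes for every [nu]. The time
    derivative of the spin cancels the cross terms of the advection, and the pressure balances the
    rest. *)
Lemma vortex_NS (D : set (spacetime R)) : smooth_axisymmetric_NS D nu vortex.
Proof.
split.
- by move=> i; rewrite vortex_compE; exact: smooth_on_eval.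
(* The horizontal velocity is a combination of the identity and the quarter turn, which commute with
   all rotations. *)
- move=> th x t _; apply/rowP => i; rewrite !mxE /vortex_comp.
  case: i => [[|[|[|//]]] ?] /=; rewrite !mxE /=; ring.
- exists (eval vortex_pressure); first exact: smooth_on_eval.
  move=> y _; split; last first.
    rewrite !big_ord_recl !big_ord0 !vortex_compE !derive_eval /= !mxE /=.
    by ring.
  move=> i; rewrite vortex_compE !derive_eval.
  under eq_bigr do rewrite derive_eval.
  rewrite (eq_bigr _ (fun j _ => derive_eval2 (vortex_comp i) (dir_x R j) (dir_x R j) y)).
  rewrite !big_ord_recl !big_ord0.
  case: i => [[|[|[|//]]] ?] /=.
  all: rewrite !mxE /=.
  all: by field.
Qed.

Lemma ur_vortex (r z t : R) : ur vortex r z t = - a * r.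
Proof. by rewrite /ur !mxE /= !mxE /=; ring. Qed.

Lemma utheta_vortex (r z t : R) : utheta vortex r z t = expR (2 * a * t) * r.
Proof. by rewrite /utheta !mxE /= !mxE /=; ring. Qed.

Lemma uz_vortex (r z t : R) : uz vortex r z t = 2 * a * z.
Proof. by rewrite /uz !mxE /= !mxE /=; ring. Qed.

(** Writing r^2 as exp(2 ln r) makes the logarithm and the real powers of the circulation affine,
    resp. exponential of affine, in t and ln r. *)
Lemma Gam_vortex (r z t : R) : 0 < r ->
  Gam vortex r z t = expR (2 * a * t + 2 * ln r).
Proof.
move=> r0; rewrite /Gam utheta_vortex expRD expRM_natl lnK ?posrE//; ring.
Qed.

Lemma phi_vortex (r z t : R) : 0 < r -> phi vortex r z t = 2 * a * t + 2 * ln r.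
Proof. by move=> r0; rewrite /phi Gam_vortex// ger0_norm ?expR_ge0// expRK. Qed.

Lemma rho_vortex (p k r z t : R) : 0 < r ->
  rho p k vortex r z t = expR (2 * a * p * t + (2 * p - k) * ln r).
Proof.
move=> r0; rewrite /rho Gam_vortex// ger0_norm ?expR_ge0//.
rewrite /powR expR_eq0 (gt_eqF r0) expRK -expRD; congr expR; ring.
Qed.

Lemma dr_phi_vortex (r z t : R) : 0 < r -> dr (phi vortex) r z t = 2 / r.
Proof.
move=> r0; refine (@dr_eq R _ (fun s => 2 * a * t + 2 * ln s) _ _ _ _ r0 _ _).
  by move=> s s0; rewrite phi_vortex.
have dln := is_derive1_ln r0.
by apply: is_derive_eq; rewrite /GRing.scale/=; ring.
Qed.

Lemma dz_phi_vortex (r z t : R) : 0 < r -> dz (phi vortex) r z t = 0.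
Proof.
move=> r0; rewrite /dz (_ : (fun s => _) = cst (2 * a * t + 2 * ln r)).
  exact: derive1_cst.
by apply/funext => s; rewrite phi_vortex.
Qed.

Lemma cr_vortex (p r z t : R) : 0 < r ->
  cr nu p vortex r z t = - a * r - 2 * p * nu / r.
Proof. by move=> r0; rewrite /cr ur_vortex dr_phi_vortex//; ring. Qed.

Lemma cz_vortex (p r z t : R) : 0 < r -> cz nu p vortex r z t = 2 * a * z.
Proof. by move=> r0; rewrite /cz uz_vortex dz_phi_vortex//; ring. Qed.

Lemma dt_rho_vortex (p k r z t : R) : 0 < r ->
  dt (rho p k vortex) r z t = rho p k vortex r z t * (2 * a * p).
Proof.
move=> r0; rewrite rho_vortex// /dt derive1E.
under eq_fun do rewrite rho_vortex//.
set c := (2 * p - k) * ln r; set e := 2 * a * p.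
have de : is_derive t 1 (fun s : R => e * s + c) e.
  by apply: is_derive_eq; rewrite /GRing.scale/=; ring.
have dexp := is_derive_expR_comp de.
exact: derive_val.
Qed.

(** With m = 2p - k, the logarithmic derivative m/r of the density multiplies -a r - 2 p nu / r,
    whose own derivative is -a + 2 p nu / r^2. *)
Lemma dr_current_vortex (p k r z t : R) : 0 < r ->
  dr (fun r z t => rho p k vortex r z t * cr nu p vortex r z t) r z t =
  rho p k vortex r z t *
    (- (2 * p - k + 1) * a - 2 * p * nu * (2 * p - k - 1) / r ^+ 2).
Proof.
move=> r0; rewrite rho_vortex//.
set c := 2 * a * p * t; set m := 2 * p - k.
refine (@dr_eq R _ (fun s => expR (c + m * ln s) * (- a * s - 2 * p * nu * s^-1))
  _ _ _ _ r0 _ _).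
  by move=> s s0; rewrite rho_vortex// cr_vortex.
have dln := is_derive1_ln r0.
have de : is_derive r 1 (fun s : R => c + m * ln s) (m / r).
  by apply: is_derive_eq; rewrite /GRing.scale/=; ring.
have dexp := is_derive_expR_comp de.
have dinv : is_derive r 1 (fun s : R => s^-1) (- r ^- 2).
  have := is_deriveV (lt0r_neq0 r0) (is_derive_id r (1 : R)).
  by rewrite /GRing.scale/= mulr1.
have dlin : is_derive r 1 (fun s : R => - a * s - 2 * p * nu * s^-1)
    (- a + 2 * p * nu / r ^+ 2).
  by apply: is_derive_eq; rewrite /GRing.scale/=; ring.
have := is_deriveM dexp dlin.
move=> /is_derive_eq; apply.
by rewrite /GRing.scale/=; field; exact: lt0r_neq0.
Qed.

Lemma dz_current_vortex (p k r z t : R) : 0 < r ->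
  dz (fun r z t => rho p k vortex r z t * cz nu p vortex r z t) r z t =
  rho p k vortex r z t * (2 * a).
Proof.
move=> r0; rewrite rho_vortex// /dz derive1E.
under eq_fun do rewrite rho_vortex// cz_vortex//.
set e := expR _.
have de : is_derive z 1 (fun s : R => e * (2 * a * s)) (e * (2 * a)).
  by apply: is_derive_eq; rewrite /GRing.scale/=; ring.
exact: derive_val.
Qed.

Lemma vortex_circulating (D : set (spacetime R)) (r z t : R) : 0 < r ->
  D (meridian r z t) -> circulating D vortex (r, z, t).
Proof.
by move=> r0 Dr; split => //; rewrite Gam_vortex//= gt_eqF// expR_gt0.
Qed.

End strained_vortex.

(** * Identifying the compression coefficient *)

(** At a = 1 the time, radial and axial terms contribute 2p, -(2p - k + 1) and 2 to the multiplier
    of [rho], with sum k + 1; the viscous 1/r^2 terms agree on both sides. *)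
Lemma compression_coefficient_unique {R : realType} (D : set (spacetime R))
    (nu p k kappa r z t : R) :
  0 < r -> D (meridian r z t) -> compression_coefficient D nu p k kappa ->
  kappa = k + 1.
Proof.
move=> r0 Dr /(_ _ (vortex_NS 1 nu D)) /(_ _ _ _ (vortex_circulating 1 r0 Dr)).
rewrite dt_rho_vortex// dr_current_vortex// dz_current_vortex// -!mulrDr.
rewrite dr_phi_vortex// dz_phi_vortex// /compression ur_vortex.
have rho0 : rho p k (vortex 1) r z t != 0.
  by rewrite rho_vortex// gt_eqF// expR_gt0.
have r_neq0 : r != 0 by rewrite gt_eqF.
move=> /(mulfI rho0) H; apply/esym/subr0_eq.
(* Zero is replaced by the difference of the two sides of the law, which is identically k + 1 -
   kappa. *)
move/eqP: H; rewrite -subr_eq0 => /eqP <-.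
by field.
Qed.

(** * Reaching the meridian half-plane inside the domain *)

Lemma open_ball_spacetime {R : realType} (D : set (spacetime R)) x t :
  open D -> D (x, t) -> exists2 e : R, 0 < e &
    forall (x' : 'rV[R]_3) (t' : R), (forall i, `|x 0 i - x' 0 i| < e) -> `|t - t'| < e ->
      D (x', t').
Proof.
move=> oD Dxt; have /nbhs_ballP[e /= e0 De] := open_nbhs_nbhs (conj oD Dxt).
exists e => // x' t' xx' tt'; apply: De; split => //=.
by split=> // i j; rewrite (ord1 i); exact: xx'.
Qed.

Lemma rotz_to_meridian {R : realType} (x : 'rV[R]_3) :
  0 < x 0 0 ^+ 2 + x 0 1 ^+ 2 ->
  exists th, rotz th x =
    vec3 (Num.sqrt (x 0 0 ^+ 2 + x 0 1 ^+ 2)) 0 (x 0 2%:R).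
Proof.
move=> x_gt0; set r := Num.sqrt _.
have r0 : 0 < r by rewrite sqrtr_gt0.
have r_neq0 : r != 0 by rewrite gt_eqF.
have r2 : r ^+ 2 = x 0 0 ^+ 2 + x 0 1 ^+ 2 by apply: sqr_sqrtr; exact: ltW.
pose c := x 0 0 / r; pose s := x 0 1 / r.
have cs : c ^+ 2 + s ^+ 2 = 1.
  by rewrite !expr_div_n -mulrDl -r2 divff// expf_neq0.
have c1 : -1 <= c <= 1.
  by rewrite -ler_norml -(@expr_le1 _ 2)// real_normK ?num_real// -cs lerDl sqr_ge0.
have cK : cos (acos c) = c by rewrite acosK.
have sK : sin (acos c) ^+ 2 = s ^+ 2.
  by rewrite sin2cos2 cK -cs addrAC subrr add0r.
(* The rotation is by minus the polar angle. [acos c] gives that angle only up to sign, so the sign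
   is chosen to match the sine. *)
have [th [cth sth]] : exists th, cos th = c /\ sin th = - s.
  move/eqP: sK; rewrite eqf_sqr => /orP[] /eqP sE.
    by exists (- acos c); rewrite cosN sinN sE.
  by exists (acos c).
exists th; apply/rowP => i; rewrite !mxE cth sth /c /s.
case: i => [[|[|[|//]]] ?] //=; last by field.
transitivity ((x 0 0 ^+ 2 + x 0 1 ^+ 2) / r); first by field.
by rewrite -r2 expr2 mulfK.
Qed.

Lemma open_meets_meridian {R : realType} (D : set (spacetime R)) :
  open D -> D !=set0 -> rotation_invariant D ->
  exists r z t : R, 0 < r /\ D (meridian r z t).
Proof.
move=> oD [[x t] Dxt] rotD.
suff [x' [x'_gt0 Dx't]] : exists x' : 'rV[R]_3,
    0 < x' 0 0 ^+ 2 + x' 0 1 ^+ 2 /\ D (x', t).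
  have [th E] := rotz_to_meridian x'_gt0.
  have := rotD th _ _ Dx't; rewrite E => D'.
  by do 3 eexists; split; last exact: D'; rewrite sqrtr_gt0.
have [x0|x0] := eqVneq (x 0 0) 0; last first.
  by exists x; split => //; rewrite ltr_wpDr ?sqr_ge0// exprn_even_gt0.
(* Here the point may lie on the axis; openness allows a shift by [e / 2] along the first
   coordinate, which leaves the axis. *)
have [e e0 De] := open_ball_spacetime oD Dxt.
exists (x + (e / 2) *: delta_mx 0 0); split.
  rewrite !mxE/= x0 add0r mulr1 ltr_wpDr ?sqr_ge0// exprn_even_gt0//=.
  by rewrite gt_eqF// divr_gt0.
apply: De => [i|]; last by rewrite subrr normr0.
rewrite !mxE eqxx/= opprD addNKr normrN ger0_norm ?mulr_ge0 ?divr_ge0// ?ltW//.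
by case: (i == 0); rewrite /= ?mulr1 ?mulr0//; lra.
Qed.

(** * Action density of a rigid rotation *)

Section rigid_rotation.
Context {R : realType}.
Variables (u : spacetime R -> 'rV[R]_3) (w nu : R).
Hypotheses (w_gt0 : 0 < w) (ur0 : forall r z t, ur u r z t = 0)
  (uthetaE : forall r z t, utheta u r z t = w * r)
  (uz0 : forall r z t, uz u r z t = 0).

Lemma phi_rigid (r z t : R) : 0 < r -> phi u r z t = ln w + 2 * ln r.
Proof.
move=> r0; rewrite /phi /Gam uthetaE ger0_norm; last first.
  by rewrite !mulr_ge0// ltW.
by rewrite !lnM ?posrE ?mulr_gt0//; ring.
Qed.

Lemma cr_rigid (p r z t : R) : 0 < r -> cr nu p u r z t = - (2 * p * nu) / r.
Proof.
move=> r0; rewrite /cr ur0.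
have -> : dr (phi u) r z t = 2 / r; last by ring.
refine (@dr_eq R _ (fun s => ln w + 2 * ln s) _ _ _ _ r0 _ _).
  by move=> s s0; rewrite phi_rigid.
have dln := is_derive1_ln r0.
by apply: is_derive_eq; rewrite /GRing.scale/=; ring.
Qed.

Lemma cz_rigid (p r z t : R) : 0 < r -> cz nu p u r z t = 0.
Proof.
move=> r0; rewrite /cz uz0 /dz (_ : (fun s => _) = cst (ln w + 2 * ln r)).
  by rewrite derive1_cst mulr0 subr0.
by apply/funext => s; rewrite phi_rigid.
Qed.

(** The circulation is w r^2 and the squared current velocity (2 p nu)^2 / r^2. A general rate [w]
    covers both [vortex 0] (rate 1) and its rescaling (rate l^-2). *)
Lemma action_density_rigid (p k r z t : R) : 0 < r ->
  rho p k u r z t * (cr nu p u r z t ^+ 2 + cz nu p u r z t ^+ 2) =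
  (2 * p * nu) ^+ 2 * w `^ p * r `^ (2 * p - k - 2).
Proof.
move=> r0; have r_neq0 : r != 0 by rewrite gt_eqF.
rewrite cr_rigid// cz_rigid// /rho /Gam uthetaE ger0_norm; last first.
  by rewrite !mulr_ge0// ltW.
rewrite mulrCA -expr2 powRM ?ltW ?exprn_gt0// -(powR_mulrn 2 (ltW r0)) -powRrM.
rewrite powRD ?r_neq0 ?implybT// powRD ?r_neq0 ?implybT//.
rewrite [_ `^ (-2)]powRN powR_mulrn ?ltW//.
by field.
Qed.

End rigid_rotation.

(** * Bounding the action over boxes *)

Definition box {R : realType} (a b c d e f : R) : set (R * R * R) :=
  (`[a, b] `*` `[c, d]) `*` `[e, f].

Section box_integral.
Context {R : realType}.
Local Notation mu := ((@lebesgue_measure R \x @lebesgue_measure R)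
         \x @lebesgue_measure R)%E.
Variables (a b c d e f : R).
Hypotheses (ab : a < b) (cd : c < d) (ef : e < f).
Local Notation B := (box a b c d e f).

Lemma measurable_box : measurable B.
Proof. by apply: measurableX; [apply: measurableX|]; exact: measurable_itv. Qed.

Lemma measure_box : mu B = ((b - a) * (d - c) * (f - e))%:E.
Proof.
rewrite product_measure1E//=; last exact: measurableX.
rewrite product_measure1E//=.
by rewrite !lebesgue_measure_itv/= !lte_fin ab cd ef !EFinM !EFinB.
Qed.

Lemma box_integral_bounds (g : R -> R) (m M : R) : 0 <= m ->
  measurable_fun [set: R] g -> (forall r, a <= r <= b -> m <= g r <= M) ->
  ((m * ((b - a) * (d - c) * (f - e)))%:E <= \int[mu]_(s in B) (g s.1.1)%:E
    <= (M * ((b - a) * (d - c) * (f - e)))%:E)%E.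
Proof.
move=> m0 mg gmM.
have gB s : B s -> m <= g s.1.1 <= M.
  by move=> -[[/=]]; rewrite in_itv/= => /gmM.
have mF : measurable_fun B (fun s : R * R * R => (g s.1.1)%:E).
  apply/measurable_EFinP; apply: measurable_funTS.
  apply: (measurableT_comp mg).
  exact: (measurableT_comp measurable_fst measurable_fst).
rewrite (EFinM m) (EFinM M) -measure_box -!integral_cst; [|exact: measurable_box..].
have mB := measurable_box.
apply/andP; split; apply: ge0_le_integral => //.
- by move=> s /gB/andP[sm sM]; rewrite lee_fin.
- by move=> s /gB/andP[sm sM]; rewrite lee_fin (le_trans m0).
- by move=> s /gB/andP[sm sM]; rewrite lee_fin.
Qed.

End box_integral.

(** At k = -1 the density is a constant times r^(2p-1), whose monotonicity depends on the sign of 2p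
    - 1; bounding r^(2p) and 1/r separately treats all p > 0 at once. *)
Lemma action_rigid_bounds {R : realType} (u : spacetime R -> 'rV[R]_3)
    (w nu p a b c d e f : R) :
  0 < w -> 0 < p -> 0 < a -> a < b -> c < d -> e < f ->
  (forall r z t, ur u r z t = 0) -> (forall r z t, utheta u r z t = w * r) ->
  (forall r z t, uz u r z t = 0) ->
  (((2 * p * nu) ^+ 2 * w `^ p * (a `^ (2 * p) / b) *
      ((b - a) * (d - c) * (f - e)))%:E
    <= action nu p (-1) u (box a b c d e f)
    <= ((2 * p * nu) ^+ 2 * w `^ p * (b `^ (2 * p) / a) *
      ((b - a) * (d - c) * (f - e)))%:E)%E.
Proof.
move=> w0 p0 a0 ab cd ef ur0 utE uz0.
set K := (2 * p * nu) ^+ 2 * w `^ p.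
have K0 : 0 <= K by rewrite mulr_ge0 ?sqr_ge0 ?powR_ge0.
have b0 := lt_trans a0 ab.
pose g r := K * r `^ (2 * p - 1).
have -> : action nu p (-1) u (box a b c d e f) =
    (\int[(@lebesgue_measure R \x @lebesgue_measure R)
         \x @lebesgue_measure R]_(s in box a b c d e f) (g s.1.1)%:E)%E.
  apply: eq_integral => s; rewrite inE => -[[/= +] _ _].
  rewrite in_itv/= => /andP[/(lt_le_trans a0) s0 _].
  rewrite (action_density_rigid _ w0)// /g.
  by congr (_ * _ `^ _)%:E; ring.
apply: box_integral_bounds => //.
- by rewrite mulr_ge0// divr_ge0 ?powR_ge0// ltW.
- apply: measurable_funM => //; exact: measurable_powR.
- move=> r /andP[ar rb]; have r0 := lt_le_trans a0 ar.
  have -> : g r = K * (r `^ (2 * p) / r).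
    rewrite /g powRB; last by rewrite (gt_eqF r0) implybT.
    by rewrite powRr1// ltW.
  have p2 : 0 <= 2 * p by rewrite mulr_ge0 ?ltW.
  have pow_le x y : 0 < x -> x <= y -> x `^ (2 * p) <= y `^ (2 * p).
    move=> x0 xy; have y0 := lt_le_trans x0 xy.
    by apply: ge0_ler_powR => //; rewrite nnegrE ltW.
  apply/andP; split; apply: ler_wpM2l => //; apply: ler_pM;
    rewrite ?powR_ge0 ?invr_ge0 ?pow_le ?lef_pV2 ?posrE//; exact: ltW.
Qed.

(** * Failure of scale invariance at k = -1 *)

Lemma rescale_box {R : realType} (l a b c d e f : R) : 0 < l ->
  rescale_region l
    (box (l * a) (l * b) (l * c) (l * d) (l ^+ 2 * e) (l ^+ 2 * f)) =
  box a b c d e f.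
Proof.
move=> l0; rewrite /rescale_region /box; apply/seteqP.
by split=> -[[r z] t] /=; rewrite /= !in_itv/= !ler_pM2l// exprn_gt0.
Qed.

(* With K = (2 p nu)^2, the density on the first box is at most K M, that on the
   rescaled box is at least K m / l, and volumes grow by l^4; taking l with l m > M makes
   these crude bounds suffice, without a change of variables. *)
Lemma rescaled_action_gt {R : realType} (nu p a b c d e f : R) :
  0 < nu -> 0 < p -> 0 < a -> a < b -> c < d -> e < f ->
  exists2 l : R, 0 < l &
    (action nu p (-1) (vortex 0) (box a b c d e f) <
     action nu p (-1) (rescale l (vortex 0))
       (box (l * a) (l * b) (l * c) (l * d) (l ^+ 2 * e) (l ^+ 2 * f)))%E.
Proof.
move=> nu0 p0 a0 ab cd ef; have b0 := lt_trans a0 ab.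
set m := a `^ (2 * p) / b; set M := b `^ (2 * p) / a.
have m0 : 0 < m by rewrite divr_gt0 ?powR_gt0.
have M0 : 0 < M by rewrite divr_gt0 ?powR_gt0.
have [l l1 lm] : exists2 l, 1 <= l & l * m = m + M.
  exists (1 + M / m); first by rewrite lerDl ltW// divr_gt0.
  by rewrite mulrDl mul1r divfK// gt_eqF.
have l0 : 0 < l := lt_le_trans ltr01 l1.
have l2 : 0 < l ^+ 2 by rewrite exprn_gt0.
exists l => //.
have ur_u (r' z' t' : R) : ur (vortex 0) r' z' t' = 0.
  by rewrite ur_vortex oppr0 mul0r.
have ut_u (r' z' t' : R) : utheta (vortex 0) r' z' t' = 1 * r'.
  by rewrite utheta_vortex mulr0 mul0r expR0.
have uz_u (r' z' t' : R) : uz (vortex 0) r' z' t' = 0.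
  by rewrite uz_vortex mulr0 mul0r.
have /andP[_ upper] :=
  action_rigid_bounds nu ltr01 p0 a0 ab cd ef ur_u ut_u uz_u.
have ur_lu (r' z' t' : R) : ur (rescale l (vortex 0)) r' z' t' = 0.
  by rewrite /ur !mxE /= !mxE /=; ring.
have ut_lu (r' z' t' : R) : utheta (rescale l (vortex 0)) r' z' t' = l ^- 2 * r'.
  rewrite /utheta !mxE /= !mxE /= mulr0 mul0r expR0; field.
  by rewrite gt_eqF.
have uz_lu (r' z' t' : R) : uz (rescale l (vortex 0)) r' z' t' = 0.
  by rewrite /uz !mxE /= !mxE /=; ring.
have lw0 : 0 < l ^- 2 by rewrite invr_gt0.
have la0 : 0 < l * a by rewrite mulr_gt0.
have lab : l * a < l * b by rewrite ltr_pM2l.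
have lcd : l * c < l * d by rewrite ltr_pM2l.
have lef : l ^+ 2 * e < l ^+ 2 * f by rewrite ltr_pM2l.
have /andP[lower _] :=
  action_rigid_bounds nu lw0 p0 la0 lab lcd lef ur_lu ut_lu uz_lu.
apply: le_lt_trans upper _; apply: lt_le_trans lower; rewrite lte_fin.
set V := (b - a) * _ * _.
have V0 : 0 < V by rewrite mulr_gt0 ?subr_gt0// mulr_gt0 ?subr_gt0.
have K0 : 0 < (2 * p * nu) ^+ 2 by apply/exprn_gt0/mulr_gt0 => //; exact: mulr_gt0.
have -> : (l * a) `^ (2 * p) / (l * b) = (l ^+ 2) `^ p * m / l.
  rewrite powRM ?ltW// powRrM powR_mulrn ?ltW// /m.
  by field; rewrite !gt_eqF.
have -> : (l * b - l * a) * (l * d - l * c) * (l ^+ 2 * f - l ^+ 2 * e)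
    = l ^+ 4 * V by rewrite /V; ring.
(* The slower rate of the rescaled rotation exactly offsets the larger radii, so only l^4 from the
   volume and 1/l from the density survive. *)
have wl : (l ^- 2) `^ p * (l ^+ 2) `^ p = 1.
  by rewrite -powRM ?invr_ge0 ?ltW// mulVf ?powR1// gt_eqF.
have -> : (2 * p * nu) ^+ 2 * (l ^- 2) `^ p * ((l ^+ 2) `^ p * m / l)
    * (l ^+ 4 * V) = (2 * p * nu) ^+ 2 * (l ^+ 3 * m) * V.
  transitivity ((2 * p * nu) ^+ 2 * (l ^+ 3 * m) * V
    * ((l ^- 2) `^ p * (l ^+ 2) `^ p)); last by rewrite wl mulr1.
  by field; rewrite gt_eqF.
rewrite powR1 mulr1 ltr_pM2r// ltr_pM2l//.
(* What remains is M < l^3 m; [1 <= l] gives l <= l^3. *)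
have : M < l * m by rewrite lm ltrDr.
move=> /lt_le_trans; apply; rewrite ler_pM2r//.
by rewrite -[leLHS]expr1 ler_weXn2l.
Qed.

(** [scale_zero] constrains only the rescaled region to lie over [D]. So that region is taken to be
    a small box about the given point, and [A] its blow-up by [l], which may leave [D]. *)
Lemma not_scale_zero_m1 {R : realType} (D : set (spacetime R))
    (nu p r z t : R) :
  open D -> 0 < r -> D (meridian r z t) -> 0 < nu -> 0 < p ->
  ~ scale_zero D nu p (-1).
Proof.
move=> oD r0 Dr nu0 p0 scale0.
have [e' e'0 De] := open_ball_spacetime oD Dr.
(* Half the minimum makes the closed box stay inside [D] and off the axis. *)
pose e := Num.min e' r / 2.
have e0 : 0 < e by rewrite divr_gt0// lt_min e'0.
have [mine' minr] : Num.min e' r <= e' /\ Num.min e' r <= r.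
  by rewrite !ge_min !lexx orbT.
have ee' : e < e' by rewrite /e; lra.
have er : e < r by rewrite /e; lra.
pose a := r - e; pose b := r + e.
have a0 : 0 < a by rewrite subr_gt0.
have ab : a < b by rewrite /a /b; lra.
have cd : z - e < z + e by lra.
have ef : t - e < t + e by lra.
have [l l0 gap] := rescaled_action_gt nu0 p0 a0 ab cd ef.
pose A := box (l * a) (l * b) (l * (z - e)) (l * (z + e))
  (l ^+ 2 * (t - e)) (l ^+ 2 * (t + e)).
have AE : rescale_region l A = box a b (z - e) (z + e) (t - e) (t + e).
  exact: rescale_box.
have sub : rescale_region l A `<=` circulating D (vortex 0).
  rewrite AE => -[[r' z'] t'] [[/=]]; rewrite !in_itv/=.
  move=> /andP[ar' r'b] /andP[zz' z'z] /andP[tt' t't].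
  apply: (vortex_circulating 0); first exact: lt_le_trans ar'.
  apply: De => [i|].
    rewrite !mxE; apply: le_lt_trans ee'.
    case: i => [[|[|[|//]]] ?] /=; [|by rewrite subrr normr0 ltW|];
      rewrite ler_norml; apply/andP; split; rewrite /a /b in ar' r'b; lra.
  by apply: le_lt_trans ee'; rewrite ler_norml; apply/andP; split; lra.
have scaleA := scale0 (vortex 0) (vortex_NS 0 nu D) l A l0
  (measurable_box _ _ _ _ _ _) sub.
by move: gap; rewrite scaleA AE ltxx.
Qed.

(** * Incompatibility of the two conditions *)

Theorem corollary11p4 (R : realType) (D : set (spacetime R)) (nu : R)
    (openD : open D) (D0 : D !=set0) (rotD : rotation_invariant D)
    (nu_gt0 : 0 < nu) :
  forall p k : R, 0 < p ->
    ~ (compression_free D nu p k /\ scale_zero D nu p k).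
Proof.
move=> p k p0 [free scale0].
have [r [z [t [r0 Dr]]]] := open_meets_meridian openD D0 rotD.
have kE : k = -1.
  apply/eqP; rewrite eq_sym -subr_eq0 -opprD oppr_eq0 addrC.
  by rewrite -(compression_coefficient_unique r0 Dr free).
by rewrite kE in scale0; exact: not_scale_zero_m1 openD r0 Dr nu_gt0 p0 scale0.
Qed.
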